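(* Let $\psi(\theta,r)=\phi(r\cos\theta,r\sin\theta)$ be the polar representation of the unique real analytic local center manifold $z=\phi(w_1,w_2)$ of the system $$\dot z = Bz+\bar Z(w_1,w_2,z),\qquad \dot w_1=-w_2+P(w_1,w_2),\qquad \dot w_2=w_1+Q(w_1,w_2)$$ (with the standing assumptions in the context), and let $\frac{dr}{d\theta}=rR(\theta,r)$ be the associated radial equation. Suppose that $\psi$ is defined on the cylinder $\Omega=\{(\theta,r):0\le\theta\le 2\pi,\ 0\le r\le\epsilon\}$, and let $0<\tilde\epsilon<\epsilon$ be chosen so that if $r:[0,2\pi]\to\mathbb{R}$ is a trajectory of $\frac{dr}{d\theta}=rR(\theta,r)$ with $0\le r(0)\le\tilde\epsilon$, then $r(\theta)<\epsilon$ for all $\theta\in[0,2\pi]$. Fix an integer $N\ge 1$. For each integer $k\ge 1$, let $\tilde\psi_k$ be the patchy approximation of order $N$ (defined in the context) with step-sizes $r_j(0)-r_{j-1}(0)=\epsilon_j:=\frac{1}{k+1}\tilde\epsilon$ for $j=0,1,\ldots,k$. Then $\tilde\psi_k\to\psi$ as $k\to\infty$, uniformly in $\tilde\Omega=\{(\theta,r):0\le\theta\le2\pi,\ 0\le r\le r_k(\theta)\}$ (here $r_k$ is the trajectory of the radial equation with $r_k(0)=\tilde\epsilon$, so $\tilde\Omega$ does not depend on $k$).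
   Context: Standing assumptions. Here $w=(w_1,w_2)\in\mathbb{R}^2$, $z\in\mathbb{R}^n$, the maps $\bar Z,P,Q$ are real analytic about the origin with Taylor series beginning with quadratic terms, the eigenvalues of the matrix $B$ have non-zero real parts, and $w=0$ is a Lyapunov stable and non-attractive equilibrium of the $w$-dynamics. Under these assumptions there is (by a theorem of Aulbach) a unique local center manifold $z=\phi(w_1,w_2)$ with $\phi$ real analytic near $w=0$ and $\phi(0)=0$. That is, $\phi$ solves $$\frac{\partial\phi}{\partial w_1}(-w_2+P)+\frac{\partial\phi}{\partial w_2}(w_1+Q)=B\phi+\bar Z(w_1,w_2,\phi).$$ Polar form. With $(w_1,w_2)=(r\cos\theta,r\sin\theta)$ the $w$-dynamics become $\dot r=r\hat R(\theta,r)$, $\dot\theta=1+\hat\Theta(\theta,r)$, with $\hat R,\hat\Theta$ analytic and $2\pi$-periodic in $\theta$ and $\hat\Theta(\theta,0)=0$. Eliminating time gives the radial equation $\frac{dr}{d\theta}=rR(\theta,r)$ with $R=\hat R/(1+\hat\Theta)$; $\epsilon$ is understood to be small enough that $1+\hat\Theta>0$ and $R$ is analytic on $\Omega$. The function $\psi(\theta,r)=\phi(r\cos\theta,r\sin\theta)$ is real analytic on $\Omega$, is $2\pi$-periodic in $\theta$, and satisfies $\psi(\theta,0)=0$. Patchy approximation of order $N$. Given $k\ge1$ and step-sizes $\epsilon_0,\ldots,\epsilon_k>0$, set $r_{-1}(\theta)=0$. For $j=0,\ldots,k$ let $r_j(\theta)$, $\theta\in[0,2\pi]$, be the solution of $\frac{dr}{d\theta}=rR(\theta,r)$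 with $r_j(0)=\sum_{i=0}^{j}\epsilon_i$. For $j=0,\ldots,k$ let $$\psi_j(\theta,r)=\sum_{i=0}^{N}\frac{1}{i!}\,\frac{\partial^i\psi}{\partial r^i}(\theta,r_{j-1}(\theta))\,(r-r_{j-1}(\theta))^i$$ be the order-$N$ radial Taylor polynomial of $\psi$ about the curve $r=r_{j-1}(\theta)$ (with exact coefficients). Then, for $\theta\in[0,2\pi]$, $\tilde\psi_k$ is defined piecewise by $\tilde\psi_k(\theta,r)=\psi_j(\theta,r)$ for $r_{j-1}(\theta)\le r<r_j(\theta)$, $0\le j\le k$, where for $j=k$ the endpoint $r=r_k(\theta)$ is also included. *)

(* Defs.v *)
From HB Require Import structures.
From mathcomp Require Import all_boot all_order all_algebra.
From mathcomp Require Import all_classical all_reals all_analysis.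
From mathcomp Require Import complex.
Set Implicit Arguments.
Unset Strict Implicit.
Unset Printing Implicit Defensive.
Import Order.TTheory GRing.Theory Num.Theory.
Import numFieldNormedType.Exports.
Local Open Scope ring_scope.
Local Open Scope classical_set_scope.

Section Analytic.
Context {R : realType}.

(* [f x] is, on a polydisc about [x0], the sum of the absolutely convergent
   multiple power series sum_a c_a (x - x0)^a; multi-indices [a] are exhausted
   by the boxes {0, .., n-1}^m. *)
Definition power_expansion m (f : 'rV[R]_m -> R) (x0 : 'rV[R]_m)
    (c : {ffun 'I_m -> nat} -> R) : Prop :=
  exists2 rho : R, 0 < rho &
    (exists M : R, forall n : nat,
       \sum_(a : {ffun 'I_m -> 'I_n})
          `|c [ffun i => val (a i)]| * \prod_(i < m) rho ^+ a i <= M) /\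
    (forall x : 'rV[R]_m, (forall i, `|x 0 i - x0 0 i| < rho) ->
       (fun n : nat => \sum_(a : {ffun 'I_m -> 'I_n})
          c [ffun i => val (a i)] * \prod_(i < m) (x 0 i - x0 0 i) ^+ a i)
         @ \oo --> f x).

Definition analytic_at m (f : 'rV[R]_m -> R) (x0 : 'rV[R]_m) : Prop :=
  exists c, power_expansion f x0 c.

(* analytic about the origin, with Taylor series beginning with quadratic
   terms *)
Definition analytic_order2 m (f : 'rV[R]_m -> R) : Prop :=
  exists2 c, power_expansion f 0 c &
    forall a : {ffun 'I_m -> nat}, (\sum_(i < m) a i < 2)%N -> c a = 0.

Definition of_row2 T (f : R -> R -> T) (v : 'rV[R]_2) : T :=
  f (v 0 0) (v 0 1).

Definition row2 (x y : R) : 'rV[R]_2 := \row_(j < 2) [:: x; y]`_j.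

Definition of_row2n n T (f : R -> R -> 'cV[R]_n -> T) (v : 'rV[R]_(2 + n)) : T :=
  f (lsubmx v 0 0) (lsubmx v 0 1) (rsubmx v)^T.

End Analytic.

Section System.
Context {R : realType}.

Definition hyperbolic n (B : 'M[R]_n) : Prop :=
  forall l : R[i], eigenvalue (map_mx (real_complex R) B) l ->
    complex.Re l != 0.

Variables P Q : R -> R -> R.

Definition enorm2 (x y : R) : R := Num.sqrt (x ^+ 2 + y ^+ 2).

Definition w_solution (T : R) (u v : R -> R) : Prop :=
  [/\ {within `[0, T], continuous u}, {within `[0, T], continuous v} &
      forall t, t \in `]0, T[ ->
        is_derive t 1 u (- v t + P (u t) (v t)) /\
        is_derive t 1 v (u t + Q (u t) (v t))].

(* Quantifying over solutions on every bounded interval [0, T], rather than on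
   [0, +oo[, also excludes escape in finite time. *)
Definition lyapunov_stable : Prop :=
  forall e : R, 0 < e -> exists2 d : R, 0 < d &
    forall (T : R) (u v : R -> R), 0 < T -> w_solution T u v ->
      enorm2 (u 0) (v 0) < d ->
      forall t, t \in `[0, T] -> enorm2 (u t) (v t) < e.

Definition attractive : Prop :=
  exists2 d : R, 0 < d &
    forall u v : R -> R, (forall T : R, 0 < T -> w_solution T u v) ->
      enorm2 (u 0) (v 0) < d ->
      u t @[t --> +oo] --> (0 : R) /\ v t @[t --> +oo] --> (0 : R).

Definition local_center_manifold n (B : 'M[R]_n)
    (Z : R -> R -> 'cV[R]_n -> 'cV[R]_n) (U : set (R * R))
    (phi : R -> R -> 'cV[R]_n) : Prop :=
  [/\ open U, U (0, 0), phi 0 0 = 0,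
      (forall x y, U (x, y) -> forall i,
         analytic_at (of_row2 (fun a b => phi a b i 0)) (row2 x y)) &
      (forall x y, U (x, y) ->
         (- y + P x y) *: derive1 (phi^~ y) x + (x + Q x y) *: derive1 (phi x) y
         = B *m phi x y + Z x y (phi x y))].

(* Polar form r' = r * Rhat, theta' = 1 + Thetahat.  Since P and Q are
   O(r^2), both vanish at r = 0, which agrees with the convention x / 0 = 0. *)
Definition Rhat (th r : R) : R :=
  (cos th * P (r * cos th) (r * sin th) +
   sin th * Q (r * cos th) (r * sin th)) / r.

Definition Thetahat (th r : R) : R :=
  (cos th * Q (r * cos th) (r * sin th) -
   sin th * P (r * cos th) (r * sin th)) / r.

Definition radialR (th r : R) : R := Rhat th r / (1 + Thetahat th r).

Definition radial_trajectory (r : R -> R) : Prop :=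
  {within `[0, 2 * pi], continuous r} /\
  forall th, th \in `]0, 2 * pi[ ->
    is_derive th 1 r (r th * radialR th (r th)).

End System.

Section Patchy.
Context {R : realType}.

Definition cylinder (e : R) : set (R * R) :=
  [set p | 0 <= p.1 <= 2 * pi /\ 0 <= p.2 <= e].

Definition region_below (r : R -> R) : set (R * R) :=
  [set p | 0 <= p.1 <= 2 * pi /\ 0 <= p.2 <= r p.1].

Definition polar T (phi : R -> R -> T) (th r : R) : T :=
  phi (r * cos th) (r * sin th).

Variables (n : nat) (psi : R -> R -> 'cV[R]_n) (N : nat).

Definition radial_taylor (c : R -> R) (th x : R) : 'cV[R]_n :=
  \sum_(i < N.+1)
     ((i`!%:R)^-1 * (x - c th) ^+ i) *: derive1n i (psi th) (c th).

(* [prev_curve r j] is r_{j-1}, with r_{-1} = 0 *)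
Definition prev_curve (r : nat -> R -> R) (j : nat) : R -> R :=
  if j is j'.+1 then r j' else fun=> 0.

Definition in_patch (r : nat -> R -> R) (k j : nat) (th x : R) : bool :=
  (prev_curve r j th <= x) && (x < r j th ?<= if (j == k)%N).

(* The patches 0 <= j <= k are disjoint when r_0 < r_1 < .. < r_k; the value
   outside of their union is irrelevant. *)
Definition patchy (r : nat -> R -> R) (k : nat) (th x : R) : 'cV[R]_n :=
  if [pick j : 'I_k.+1 | in_patch r k j th x] is Some j
  then radial_taylor (prev_curve r j) th x else 0.

End Patchy.

(* Main.v *)
Require Import Defs.
From mathcomp Require Import all_boot all_order all_algebra.
From mathcomp Require Import all_classical all_reals all_analysis.
From mathcomp Require Import ring lra.
Import Order.TTheory GRing.Theory Num.Theory.
Import numFieldNormedType.Exports.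
Local Open Scope ring_scope.
Local Open Scope classical_set_scope.

(** The error of an order-N radial Taylor polynomial of psi about the curve
    r = r_{j-1}(theta) is controlled by a power of the distance to that curve,
    so two facts suffice: the constants in the Taylor estimate can be chosen
    uniformly over the cylinder, and the width r_j(theta) - r_{j-1}(theta) of
    the widest patch tends to 0, uniformly in theta.

    Uniform Taylor estimate.  Near an analytic point, f is a sum of an
    absolutely convergent multiple power series on a box of radius s.
    Re-expanding it along a line h |-> f (y + h v), with y within s / 2 of
    the centre and |v_i| <= 1, yields a power series in h which converges for
    |h| < s / 2 and whose weighted coefficient sum is bounded by that of the
    original series, whatever y and v are ([analytic_along_lines]).  A bound M
    on the weighted coefficient sum for the radius delta gives the remainder
    estimate M (|h| / delta)^N at once ([bounded_pseries_remainder]), and the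
    coefficients are the iterated derivatives divided by factorials
    ([derive1n_pseries]).  Radial lines in the cylinder are lines in the
    w-plane with direction (cos theta, sin theta), so delta and M exist
    locally, hence by compactness on the whole cylinder
    ([polar_bounded_pseries]).

    Width of the patches.  The same expansion applied to R makes the field
    r R(theta, r) Lipschitz in r on the cylinder ([field_lipschitz]), so by
    Gronwall's inequality two trajectories that start teps / (k + 1) apart stay
    within exp (2 pi L) teps / (k + 1) of each other ([trajectories_gap]).
    This needs the trajectories to remain in the cylinder: the upper bound is
    assumed, and the lower one holds because r = 0 is itself a trajectory
    ([trajectory_ge0]).

    Finally every point below the outermost curve lies in some patch
    ([patchyE]), because the first lower boundary is r = 0. *)

(** * Majorant polynomials *)

Section Majorants.
Context {R : realType}.
Implicit Types p q : {poly R}.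

Definition dominated p q := forall k, `|p`_k| <= q`_k.

Lemma dominated_ge0 p q k : dominated p q -> 0 <= q`_k.
Proof. by move=> /(_ k); apply: le_trans. Qed.

Lemma dominatedC (c d : R) : `|c| <= d -> dominated c%:P d%:P.
Proof. by move=> cd k; rewrite !coefC; case: ifP; rewrite ?normr0. Qed.

Lemma dominatedZX (c : R) : `|c| <= 1 -> dominated (c *: 'X) 'X.
Proof.
move=> c1 k; rewrite coefZ coefX.
by case: (k == 1)%N; rewrite ?mulr1 ?mulr0 ?normr0.
Qed.

Lemma dominatedD p1 q1 p2 q2 :
  dominated p1 q1 -> dominated p2 q2 -> dominated (p1 + p2) (q1 + q2).
Proof. by move=> h1 h2 k; rewrite !coefD (le_trans (ler_normD _ _))// lerD. Qed.

Lemma dominatedM p1 q1 p2 q2 :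
  dominated p1 q1 -> dominated p2 q2 -> dominated (p1 * p2) (q1 * q2).
Proof.
move=> h1 h2 k; rewrite !coefM (le_trans (ler_norm_sum _ _ _))//.
by apply: ler_sum => i _; rewrite normrM ler_pM.
Qed.

Lemma dominatedZ (c : R) p q : dominated p q -> dominated (c *: p) (`|c| *: q).
Proof. by move=> h k; rewrite !coefZ normrM ler_wpM2l. Qed.

Lemma dominatedX n p q : dominated p q -> dominated (p ^+ n) (q ^+ n).
Proof.
move=> h; elim: n => [|n IH]; last by rewrite !exprS; exact: dominatedM.
by rewrite !expr0 -polyC1; apply: dominatedC; rewrite normr1.
Qed.

Lemma dominated_prod (I : finType) (F G : I -> {poly R}) :
  (forall i, dominated (F i) (G i)) -> dominated (\prod_i F i) (\prod_i G i).
Proof.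
move=> h; elim/big_rec2: _ => [|i p q _]; last exact: dominatedM.
by rewrite -polyC1; apply: dominatedC; rewrite normr1.
Qed.

Lemma dominated_sum (I : finType) (A : pred I) (F G : I -> {poly R}) :
  (forall i, dominated (F i) (G i)) ->
  dominated (\sum_(i | A i) F i) (\sum_(i | A i) G i).
Proof.
move=> h; elim/big_rec2: _ => [|i p q _]; last exact: dominatedD.
by rewrite -polyC0; apply: dominatedC; rewrite normr0.
Qed.

(** A majorant turns the weighted coefficient sum of [p], which is not
    multiplicative, into the value of [q] at a point, which is. *)
Lemma dominated_norm_le p q (x : R) K : 0 <= x -> dominated p q ->
  \sum_(k < K) `|p`_k| * x ^+ k <= q.[x].
Proof.
move=> x0 pq; rewrite (@horner_coef_wide _ (maxn K (size q)) q x) ?leq_maxr//.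
rewrite (big_ord_widen _ (fun k => `|p`_k| * x ^+ k) (leq_maxl K (size q))).
apply: (@le_trans _ _ (\sum_(i < maxn K (size q) | (i < K)%N) q`_i * x ^+ i)).
  by apply: ler_sum => i _; rewrite ler_wpM2r ?exprn_ge0// pq.
rewrite [leRHS](bigID (fun i : 'I__ => (i < K)%N))/= lerDl.
apply: sumr_ge0 => i _; rewrite mulr_ge0 ?exprn_ge0//.
exact: dominated_ge0 pq.
Qed.

(** The weighted sum of the absolute values of the coefficients is bounded,
    rather than [g] itself: such a bound passes to limits coefficientwise,
    controls every Taylor remainder, and is inherited by smaller radii. *)
Definition bounded_pseries (g : R -> R) (delta M : R) :=
  exists2 d : R^nat, (forall K, \sum_(k < K) `|d k| * delta ^+ k <= M) &
    forall h, `|h| < delta -> pseries d h @ \oo --> g h.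

(** If the increments of a sequence of polynomials are majorized by those of a
    sequence with bounded values at [delta], then the polynomials converge
    coefficientwise and their pointwise limit is the sum of the limit series.
    The bound on the weighted coefficient sums is what allows exchanging the
    limit in [n] with the sum over the coefficients. *)
Lemma dominated_limit (p q : nat -> {poly R}) (g : R -> R) (delta M : R) :
  0 < delta -> dominated (p 0%N) (q 0%N) ->
  (forall m n, (m <= n)%N -> dominated (p n - p m) (q n - q m)) ->
  (forall n, (q n).[delta] <= M) ->
  (forall h, `|h| < delta -> (fun n => (p n).[h]) @ \oo --> g h) ->
  bounded_pseries g delta M.
Proof.
move=> d0 pq0 pqB qM pg.
have pq n : dominated (p n) (q n).
  by have := dominatedD _ _ _ _ pq0 (pqB 0%N n (leq0n n)); rewrite !subrKC.
have qk n k : (q n)`_k <= M / delta ^+ k.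
  rewrite ler_pdivlMr ?exprn_gt0//; apply: le_trans (qM n).
  have qq : dominated (q n) (q n).
    by move=> i; rewrite ger0_norm//; exact: dominated_ge0 (pq n).
  apply: le_trans (dominated_norm_le _ _ _ k.+1 (ltW d0) qq).
  rewrite big_ord_recr/= ger0_norm ?(dominated_ge0 _ _ _ qq)//.
  by rewrite lerDr; apply: sumr_ge0 => i _; rewrite mulr_ge0// exprn_ge0// ltW.
have cq k : cvgn (fun n => (q n)`_k).
  apply: nondecreasing_is_cvgn.
    move=> m n mn; rewrite -subr_ge0 -coefB.
    exact: dominated_ge0 (pqB m n mn).
  by exists (M / delta ^+ k) => _ [n _ <-].
(* The increments of [q] bound those of [p], so [q + p] is nondecreasing too;
   this gives the convergence of [p] without a Cauchy argument. *)
have cpq k : cvgn (fun n => (q n)`_k + (p n)`_k).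
  apply: nondecreasing_is_cvgn.
    move=> m n mn; have := pqB m n mn k; rewrite !coefB ler_norml => /andP[+ _].
    lra.
  exists (M / delta ^+ k + M / delta ^+ k) => _ [n _ <-].
  by rewrite lerD// (le_trans (ler_norm _))// (le_trans (pq n k)).
have cp k : cvgn (fun n => (p n)`_k).
  have -> : (fun n => (p n)`_k) =
            (fun n => ((q n)`_k + (p n)`_k) - (q n)`_k).
    by apply/funext => n; rewrite [_ + (p n)`_k]addrC addrK.
  exact: is_cvgB.
pose d k := limn (fun n => (p n)`_k).
have cs : cvgn (fun n => (q n).[delta]).
  apply: nondecreasing_is_cvgn; last by exists M => _ [n _ <-].
  move=> m n mn; rewrite -subr_ge0 -hornerN -hornerD.
  apply: le_trans (dominated_norm_le _ _ _ 0 (ltW d0) (pqB m n mn)).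
  by rewrite big_ord0.
set S := limn (fun n => (q n).[delta]) in cs.
have sum_le (u : nat -> nat -> R) (l : R^nat) (B : R^nat) K :
    (forall k, u k @ \oo --> l k) -> cvgn B ->
    (\forall n \near \oo, \sum_(k < K) `|u k n| * delta ^+ k <= B n) ->
    \sum_(k < K) `|l k| * delta ^+ k <= limn B.
  move=> ul cB uB.
  have cl : (fun n => \sum_(k < K) `|u k n| * delta ^+ k) @ \oo -->
      \sum_(k < K) `|l k| * delta ^+ k.
    apply: cvg_big => [|k _]; first exact: add_continuous.
    apply: cvgM; last exact: cvg_cst.
    exact: cvg_norm.
  rewrite -(cvg_lim _ cl)//; apply: ler_lim => //.
  by apply/cvg_ex; eexists; exact: cl.
exists d => [K|h hd].
  apply: le_trans (_ : S <= M).
    apply: (sum_le (fun k n => (p n)`_k) d (fun n => (q n).[delta]) K) => //.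
    by near=> n; apply: dominated_norm_le => //; exact: ltW.
  by apply: limr_le => //; near=> n.
(* Applying the bound to the increments from [m] on shows that the partial sums
   of the limit series are close to [p m], uniformly in their length. *)
have tail m K :
    \sum_(k < K) `|d k - (p m)`_k| * delta ^+ k <= S - (q m).[delta].
  have -> : S - (q m).[delta] = limn (fun n => (q n).[delta] - (q m).[delta]).
    by apply/esym/cvg_lim => //; apply: cvgB => //; exact: cvg_cst.
  apply: (sum_le (fun k n => (p n)`_k - (p m)`_k) (fun k => d k - (p m)`_k)
    (fun n => (q n).[delta] - (q m).[delta]) K).
  - by move=> k; apply: cvgB; [exact: cp|exact: cvg_cst].
  - by apply: is_cvgB => //; exact: is_cvg_cst.
  - near=> n; rewrite -hornerN -hornerD.
    under eq_bigr do rewrite -coefB.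
    apply: dominated_norm_le; first exact: ltW.
    by apply: pqB; near: n; exact: nbhs_infty_ge.
apply/cvgrPdist_lt => e e0.
have e20 : 0 < e / 2 by rewrite divr_gt0.
have [m [mp mq]] : exists m, `|g h - (p m).[h]| < e / 2 /\
    `|S - (q m).[delta]| < e / 2.
  near \oo => m; exists m; split; near: m.
    by have /cvgrPdist_lt := pg h hd; apply.
  by have /cvgrPdist_lt := cs; apply.
near=> K.
rewrite -[_ - _](subrKA (p m).[h]) (splitr e).
rewrite (le_lt_trans (ler_normD _ _))// ltrD//.
apply: le_lt_trans mq; apply: le_trans (ler_norm _).
apply: le_trans (tail m K).
rewrite (@horner_coef_wide _ K (p m)); last by near: K; exact: nbhs_infty_ge.
rewrite /pseries/= /series/= big_mkord -sumrB (le_trans (ler_norm_sum _ _ _))//.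
apply: ler_sum => k _; rewrite -mulrBl normrM distrC normrX ler_wpM2l//.
by rewrite lerXn2r// ?nnegrE// ltW.
Unshelve. all: by end_near. Qed.

End Majorants.

(** * Analytic functions along lines *)

Section AlongLines.
Context {R : realType}.

Lemma box_sumB (V : zmodType) m (G : {ffun 'I_m -> nat} -> V) {n1 n2 : nat} :
  (n1 <= n2)%N ->
  \sum_(a : {ffun 'I_m -> 'I_n2}) G [ffun i => val (a i)] -
  \sum_(a : {ffun 'I_m -> 'I_n1}) G [ffun i => val (a i)] =
  \sum_(a : {ffun 'I_m -> 'I_n2} | ~~ [forall i, (a i < n1)%N])
     G [ffun i => val (a i)].
Proof.
move=> n12; pose h (a : {ffun 'I_m -> 'I_n1}) : {ffun 'I_m -> 'I_n2} :=
  [ffun i => widen_ord n12 (a i)].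
rewrite (bigID (fun a : {ffun 'I_m -> 'I_n2} => [forall i, (a i < n1)%N]))/=.
rewrite [X in X + _ - _](_ : _ =
    \sum_(a : {ffun 'I_m -> 'I_n1}) G [ffun i => val (a i)]).
  by rewrite addrAC subrr add0r.
transitivity (\sum_(b in (h @: [set: {ffun 'I_m -> 'I_n1}])%SET)
    G [ffun i => val (b i)]).
  apply: eq_bigl => b; apply/forallP/imsetP => [bn|[a _ ->] i]; last first.
    by rewrite ffunE /= ltn_ord.
  exists [ffun i => Ordinal (bn i)]; first by rewrite inE.
  by apply/ffunP => i; rewrite !ffunE; apply/val_inj.
rewrite big_imset/=; last first.
  move=> a b _ _ ab; apply/ffunP => i; apply/val_inj.
  have := congr1 (fun e : {ffun 'I_m -> 'I_n2} => val (e i)) ab.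
  by rewrite !ffunE.
apply: eq_big => [a|a _]; first by rewrite inE.
by congr G; apply/ffunP => i; rewrite !ffunE.
Qed.

(** Substituting [x = y + h v] in a term c_a (x - x0)^a gives a polynomial in
    [h], majorized by |c_a| (delta + X)^|a| as soon as |y_i - x0_i| <= delta
    and |v_i| <= 1.  At [h = delta] this majorant is |c_a| (2 delta)^|a|, hence
    the choice of half the radius of convergence for [delta]: the sum of the
    majorants is then the bound given for the original series. *)
Lemma analytic_along_lines m (f : 'rV[R]_m -> R) (x0 : 'rV[R]_m) :
  analytic_at f x0 ->
  exists2 delta, 0 < delta & exists M, forall y v : 'rV[R]_m,
    (forall i, `|y 0 i - x0 0 i| <= delta) -> (forall i, `|v 0 i| <= 1) ->
    bounded_pseries (fun h => f (y + h *: v)) delta M.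
Proof.
move=> [c [rho rho0 [[M cM] fc]]].
have d0 : 0 < rho / 2 by rewrite divr_gt0.
exists (rho / 2) => //; exists M => y v yx0 v1.
pose F (a : {ffun 'I_m -> nat}) : {poly R} :=
  c a *: \prod_(i < m) ((y 0 i - x0 0 i)%:P + v 0 i *: 'X) ^+ a i.
pose G (a : {ffun 'I_m -> nat}) : {poly R} :=
  `|c a| *: \prod_(i < m) ((rho / 2)%:P + 'X) ^+ a i.
have FG a : dominated (F a) (G a).
  apply/dominatedZ/dominated_prod => i; apply/dominatedX/dominatedD.
    exact: dominatedC.
  exact: dominatedZX.
apply: (@dominated_limit _
  (fun n => \sum_(a : {ffun 'I_m -> 'I_n}) F [ffun i => val (a i)])
  (fun n => \sum_(a : {ffun 'I_m -> 'I_n}) G [ffun i => val (a i)])) => //.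
- exact: dominated_sum.
- by move=> n1 n2 n12; rewrite !box_sumB//; exact: dominated_sum.
- move=> n; apply: le_trans (cM n); rewrite horner_sum le_eqVlt.
  apply/orP; left; apply/eqP; apply: eq_bigr => a _.
  rewrite hornerZ horner_prod; congr (_ * _); apply: eq_bigr => i _.
  by rewrite horner_exp hornerD hornerX hornerC -splitr ffunE.
move=> h hd.
have yhx i : `|(y + h *: v) 0 i - x0 0 i| < rho.
  rewrite !mxE addrAC (splitr rho) (le_lt_trans (ler_normD _ _))//.
  rewrite ler_ltD// normrM (le_lt_trans _ hd)// ler_piMr//.
suff -> :
    (fun n => (\sum_(a : {ffun 'I_m -> 'I_n}) F [ffun i => val (a i)]).[h]) =
      (fun n => \sum_(a : {ffun 'I_m -> 'I_n}) c [ffun i => val (a i)] *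
        \prod_(i < m) ((y + h *: v) 0 i - x0 0 i) ^+ a i) by exact: fc.
apply/funext => n.
rewrite horner_sum; apply: eq_bigr => a _.
rewrite hornerZ horner_prod; congr (_ * _); apply: eq_bigr => i _.
rewrite horner_exp hornerD hornerZ hornerX hornerC ffunE !mxE.
by congr (_ ^+ _); ring.
Qed.

Lemma row2_along_lines (f : R -> R -> R) (x0 y0 : R) :
  analytic_at (of_row2 f) (row2 x0 y0) ->
  exists2 delta, 0 < delta & exists M, forall x y p q : R,
    `|x - x0| <= delta -> `|y - y0| <= delta -> `|p| <= 1 -> `|q| <= 1 ->
    bounded_pseries (fun h => f (x + h * p) (y + h * q)) delta M.
Proof.
move=> /analytic_along_lines[delta d0 [M H]]; exists delta => //.
exists M => x y p q xx0 yy0 p1 q1.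
have ord2 (P : 'I_2 -> Prop) : P 0 -> P 1 -> forall i, P i.
  move=> P0 P1 i; case: (unliftP 0 i) => [j ->|->//].
  by rewrite ord1 (_ : lift 0 0 = 1)//; apply/val_inj.
have := H (row2 x y) (row2 p q); rewrite /of_row2.
under [X in bounded_pseries X]eq_fun do rewrite !mxE/=.
by apply; apply: ord2; rewrite !mxE.
Qed.

Lemma bounded_pseriesW (g : R -> R) (d1 d2 M1 M2 : R) : 0 <= d1 ->
  d1 <= d2 -> M2 <= M1 -> bounded_pseries g d2 M2 -> bounded_pseries g d1 M1.
Proof.
move=> d10 d12 M21 [d dM dg]; exists d => [K|h hd]; last first.
  by apply: dg; exact: lt_le_trans d12.
apply: le_trans M21; apply: le_trans (dM K); apply: ler_sum => k _.
by rewrite ler_wpM2l// lerXn2r// nnegrE// (le_trans d10).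
Qed.

(** * Remainders and derivatives of power series *)

(** For [k >= N] the ratio (|h| / delta)^k is at most (|h| / delta)^N, so the
    tail of the series is at most (|h| / delta)^N times its weighted sum. *)
Lemma bounded_pseries_remainder (d : R^nat) (delta M h l : R) N :
  0 < delta -> (forall K, \sum_(k < K) `|d k| * delta ^+ k <= M) ->
  `|h| < delta -> pseries d h @ \oo --> l ->
  `|l - \sum_(i < N) d i * h ^+ i| <= M * (`|h| / delta) ^+ N.
Proof.
move=> d0 dM hd dl.
have cl : (fun K => `|pseries d h K - \sum_(i < N) d i * h ^+ i|) @ \oo -->
    `|l - \sum_(i < N) d i * h ^+ i|.
  by apply: cvg_norm; apply: cvgB => //; exact: cvg_cst.
rewrite -(cvg_lim _ cl)//; apply: limr_le.
  by apply/cvg_ex; eexists; exact: cl.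
near=> K.
have NK : (N <= K)%N by near: K; exact: nbhs_infty_ge.
rewrite /pseries/= /series/= (big_cat_nat (leq0n N) NK)/= big_mkord.
rewrite addrAC subrr add0r (le_trans (ler_norm_sum _ _ _))//.
apply: (@le_trans _ _ ((\sum_(N <= k < K) `|d k| * delta ^+ k) *
    (`|h| / delta) ^+ N)); last first.
  have hd0 : 0 <= `|h| / delta by rewrite divr_ge0// ltW.
  rewrite ler_wpM2r ?exprn_ge0// (le_trans _ (dM K))//.
  rewrite -(big_mkord xpredT (fun k => `|d k| * delta ^+ k)).
  rewrite (big_cat_nat (leq0n N) NK)/= lerDr; apply: sumr_ge0 => i _.
  by rewrite mulr_ge0 ?exprn_ge0// ltW.
rewrite mulr_suml !big_nat; apply: ler_sum => k /andP[Nk _].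
rewrite normrM normrX -mulrA ler_wpM2l//.
have -> : delta ^+ k * (`|h| / delta) ^+ N = `|h| ^+ N * delta ^+ (k - N).
  rewrite -[in LHS](subnKC Nk) exprD expr_div_n.
  by field; rewrite gt_eqF ?exprn_gt0.
rewrite -[in leLHS](subnKC Nk) exprD ler_wpM2l ?exprn_ge0//.
by rewrite lerXn2r ?nnegrE// ltW.
Unshelve. all: by end_near. Qed.

Lemma bounded_cvg_pseries (d : R^nat) (delta M h : R) :
  (forall K, \sum_(k < K) `|d k| * delta ^+ k <= M) -> `|h| <= delta ->
  cvgn (pseries d h).
Proof.
move=> dM hd; apply: normed_cvg; apply: nondecreasing_is_cvgn.
  by apply: nondecreasing_series => n _ _; exact: normr_ge0.
exists M => _ [K _ <-]; apply: le_trans (dM K).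
rewrite /normed_series_of /series/= big_mkord; apply: ler_sum => k _.
rewrite normrM normrX ler_wpM2l// lerXn2r// nnegrE//.
exact: le_trans hd.
Qed.

(** Termwise differentiation keeps the weighted sum bounded on a smaller disc:
    (k + 1) x^k (y - x) <= y^(k + 1) - x^(k + 1), because the quotient
    (y^(k + 1) - x^(k + 1)) / (y - x) is a sum of k + 1 terms y^(k - i) x^i. *)
Lemma bounded_pseries_diffs (d : R^nat) (x y M : R) : 0 <= x -> x < y ->
  (forall K, \sum_(k < K) `|d k| * y ^+ k <= M) ->
  forall K, \sum_(k < K) `|pseries_diffs d k| * x ^+ k <= M / (y - x).
Proof.
move=> x0 xy dM K; rewrite ler_pdivlMr ?subr_gt0//.
apply: le_trans (dM K.+1).
rewrite [leRHS]big_ord_recl/= expr0 mulr1 mulr_suml.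
apply: ler_wpDl => //; apply: ler_sum => k _.
rewrite /pseries_diffs /bump/= add1n normrM normr_nat [_%:R * _]mulrC -!mulrA.
rewrite ler_wpM2l//.
apply: (@le_trans _ _ (y ^+ k.+1 - x ^+ k.+1)); last first.
  by rewrite gerBl exprn_ge0.
rewrite subrXX [leRHS]mulrC mulrA ler_wpM2r ?subr_ge0 ?(ltW xy)//.
rewrite mulr_natl -[X in _ *+ X]card_ord -sumr_const; apply: ler_sum => i _.
rewrite -[X in x ^+ X](subnK (ltn_ord i : (i <= k)%N)) exprD.
rewrite ler_wpM2r ?exprn_ge0//.
by rewrite lerXn2r ?nnegrE// (ltW xy, le_trans x0 (ltW xy)).
Qed.

Lemma iter_pseries_diffs (d : R^nat) i k :
  iter i (@pseries_diffs R) d k = ((k + i) ^_ i)%:R * d (k + i)%N.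
Proof.
elim: i k => [|i IH] k; first by rewrite ffactn0 mul1r addn0.
rewrite iterS /pseries_diffs IH mulrA -natrM addSnnS; congr (_%:R * _).
by rewrite ffactnSr mulnC -addSnnS addnK.
Qed.

Section Derivatives.
Variables (f : R -> R) (c delta M : R) (d : R^nat).
Hypothesis dM : forall K, \sum_(k < K) `|d k| * delta ^+ k <= M.
Hypothesis df : forall h, `|h| < delta -> pseries d h @ \oo --> f (c + h).

Lemma bounded_iter_pseries_diffs i x : 0 <= x -> x < delta -> exists M',
  forall K, \sum_(k < K) `|iter i (@pseries_diffs R) d k| * x ^+ k <= M'.
Proof.
elim: i x => [|i IH] x x0 xd.
  exists M => K; apply: le_trans (dM K); apply: ler_sum => k _.
  by rewrite ler_wpM2l// lerXn2r ?nnegrE// (ltW xd, le_trans x0 (ltW xd)).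
have [xy yd] := midf_lt xd.
have [M' HM'] := IH _ (le_trans x0 (ltW xy)) yd.
eexists => K; rewrite iterS.
exact: (bounded_pseries_diffs _ _ _ _ x0 xy HM').
Qed.

Lemma is_cvg_iter_pseries_diffs i h :
  `|h| < delta -> cvgn (pseries (iter i (@pseries_diffs R) d) h).
Proof.
move=> hd; have [M' HM'] := bounded_iter_pseries_diffs i _ (normr_ge0 h) hd.
exact: (bounded_cvg_pseries _ _ _ _ HM' (lexx _)).
Qed.

(** Derivatives of all orders are sums of the iterated termwise derivatives, on
    the whole disc: the identity of order [j] on a neighbourhood is what makes
    the derivative of order [j + 1] computable, so the induction is on a
    statement for all [h] at once. *)
Lemma cvg_iter_pseries_diffs i h : `|h| < delta ->
  pseries (iter i (@pseries_diffs R) d) h @ \oo --> derive1n i f (c + h) /\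
  derivable (derive1n i f) (c + h) 1.
Proof.
move: h.
suff key j : (forall h, `|h| < delta ->
      pseries (iter j (@pseries_diffs R) d) h @ \oo --> derive1n j f (c + h)) ->
    forall h, `|h| < delta -> is_derive (c + h) 1 (derive1n j f)
      (limn (pseries (iter j.+1 (@pseries_diffs R) d) h)).
  have cv : forall h, `|h| < delta ->
      pseries (iter i (@pseries_diffs R) d) h @ \oo --> derive1n i f (c + h).
    elim: i => [|i IH] h hd; first exact: df.
    have [_ fE] := key _ IH h hd.
    by rewrite derive1nS derive1E fE; exact: is_cvg_iter_pseries_diffs.
  by move=> h hd; split; [exact: cv|have [] := key _ cv h hd].
move=> IH h hd; have [xy yd] := midf_lt hd.
set y := (_ / _) in xy yd.
have y0 : 0 <= y by exact: le_trans (ltW xy).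
have cy j' : cvgn (pseries (iter j' (@pseries_diffs R) d) y).
  by apply: is_cvg_iter_pseries_diffs; rewrite ger0_norm.
have Dh : is_derive h 1 (fun x => derive1n j f (c + x))
    (limn (pseries (iter j.+1 (@pseries_diffs R) d) h)).
  apply: (@near_eq_is_derive _ _ _
    (fun x => limn (pseries (iter j (@pseries_diffs R) d) x))).
    near=> x; apply: cvg_lim => //; apply: IH.
    near: x; by apply: (@cvgr_norm_lt R R^o R (nbhs h) _ id h).
  apply: (@pseries_snd_diffs R _ y h (cy j) (cy j.+1) (cy j.+2)).
  by rewrite [ltRHS]ger0_norm.
have -> : derive1n j f = (fun x => derive1n j f (c + x)) \o shift (- c).
  by apply/funext => x /=; rewrite addrC subrK.
rewrite -[limn _]mul1r mulrC.
apply: is_derive1_comp; last exact: is_derive_shift.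
by rewrite /= addrAC subrr add0r.
Unshelve. all: by end_near. Qed.

Lemma derive1n_pseries i : 0 < delta -> derive1n i f c = i`!%:R * d i.
Proof.
move=> d0; have z0 : `|0 : R| < delta by rewrite normr0.
have [+ _] := cvg_iter_pseries_diffs i 0 z0; rewrite addr0 => fi.
have d20 : 0 < delta / 2 by rewrite divr_gt0.
have d2d : delta / 2 < delta by rewrite ltr_pdivrMr// ltr_pMr// ltr1n.
have [M' HM'] := bounded_iter_pseries_diffs i _ (ltW d20) d2d.
have z2 : `|0 : R| < delta / 2 by rewrite normr0.
have := bounded_pseries_remainder _ _ _ _ _ 1 d20 HM' z2 fi.
rewrite normr0 mul0r expr1 mulr0 normr_le0 big_ord1 expr0 mulr1 subr_eq0.
by move=> /eqP ->; rewrite iter_pseries_diffs add0n ffactnn.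
Qed.

End Derivatives.

End AlongLines.

(** * Taylor estimates *)

Section Taylor.
Context {R : realType}.

Lemma bounded_pseries_taylor (f : R -> R) (c delta M x : R) N : 0 < delta ->
  bounded_pseries (fun h => f (c + h)) delta M -> `|x - c| < delta ->
  `|f x - \sum_(i < N) (i`!%:R)^-1 * (x - c) ^+ i * derive1n i f c| <=
    M * (`|x - c| / delta) ^+ N.
Proof.
move=> d0 [d dM df] xc; have fx := df _ xc.
rewrite subrKC in fx.
apply: le_trans (bounded_pseries_remainder _ _ _ _ _ N d0 dM xc fx).
rewrite le_eqVlt; apply/orP; left; apply/eqP; congr `|_ - _|.
apply: eq_bigr => i _; rewrite (derive1n_pseries _ _ _ _ _ dM df)//.
rewrite mulrAC [RHS]mulrC mulrC; congr (_ * _).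
by rewrite mulrA mulVf ?mul1r// pnatr_eq0 -lt0n fact_gt0.
Qed.

Lemma bounded_pseries_derivable (f : R -> R) (c delta M : R) k :
  0 < delta -> bounded_pseries (fun h => f (c + h)) delta M ->
  \forall x \near c, derivable (derive1n k f) x 1.
Proof.
move=> d0 [d dM df]; near=> x.
have xc : `|x - c| < delta.
  by rewrite distrC; near: x; exact: (nbhsx_ballx c).
have [_] := cvg_iter_pseries_diffs _ _ _ _ _ dM df k _ xc.
by rewrite subrKC.
Unshelve. all: by end_near. Qed.

(** The derivative of a vector-valued function that is not derivable need not
    be the vector of the derivatives of its components; this is why the
    components are assumed derivable to all orders near the point. *)
Lemma derive1n_cV n (f : R -> 'cV[R]_n) (c : R) k :
  (forall i k,
    \forall x \near c, derivable (derive1n k (fun y => f y i 0)) x 1) ->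
  \forall x \near c, forall i,
    derive1n k f x i 0 = derive1n k (fun y => f y i 0) x.
Proof.
move=> df; elim: k => [|k IH]; first by near=> x.
have IH2 := near_join IH.
have dfk : \forall x \near c, forall j,
    derivable (derive1n k (fun y => f y j 0)) x 1.
  by apply: (filter_forall (nbhs_filter c)) => j; exact: df.
near=> x => i; rewrite !derive1nS !derive1E.
have Ax : \forall y \near x, forall i, derive1n k f y i 0 =
   derive1n k (fun y => f y i 0) y by near: x.
have Dx j : derivable (fun y => derive1n k f y j 0) x 1.
  apply: (@near_eq_derivable _ _ _ (derive1n k (fun y => f y j 0))).
    by apply: filterS Ax => y ->.
  by move: j; near: x.
rewrite derive_mx ?mxE; last by apply/derivable_mxP => a b; rewrite ord1.
by apply: near_eq_derive; apply: filterS Ax => y ->.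
Unshelve. all: by end_near. Qed.

(** The assumption on all the components [j] is local and may have constants
    depending on [j]: it only serves to compute the derivatives of [f]. *)
Lemma bounded_pseries_taylor_cV n (f : R -> 'cV[R]_n) (c delta M x : R) N i :
  (forall j, exists2 e, 0 < e &
     exists A, bounded_pseries (fun h => f (c + h) j 0) e A) ->
  0 < delta -> bounded_pseries (fun h => f (c + h) i 0) delta M ->
  `|x - c| < delta ->
  `|f x i 0 -
    (\sum_(l < N) ((l`!%:R)^-1 * (x - c) ^+ l) *: derive1n l f c) i 0| <=
    M * (`|x - c| / delta) ^+ N.
Proof.
move=> fc d0 fi xc; apply: le_trans
  (bounded_pseries_taylor (fun y => f y i 0) c delta M x N d0 fi xc).
rewrite le_eqVlt; apply/orP; left; apply/eqP; congr `|_ - _|.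
rewrite summxE; apply: eq_bigr => l _; rewrite mxE; congr (_ * _).
have fE : \forall y \near c, forall j,
    derive1n l f y j 0 = derive1n l (fun z => f z j 0) y.
  apply: derive1n_cV => j k; have [e e0 [A fj]] := fc j.
  exact: (bounded_pseries_derivable (fun y => f y j 0) c e A k e0 fj).
exact: (nbhs_singleton fE i).
Qed.

(** Since the bound persists when [delta] decreases and [M] increases, the
    single parameter [i], with [delta = 1 / (i + 1)] and [M = i + 1], describes
    it; by compactness one [i] fits all points. *)
Lemma compact_bounded_pseries (X : topologicalType) (K : set X)
    (g : X -> R -> R) :
  compact K ->
  (forall x, K x -> exists2 delta, 0 < delta &
     exists M, \forall y \near x, bounded_pseries (g y) delta M) ->
  exists2 delta, 0 < delta &
    exists M, forall x, K x -> bounded_pseries (g x) delta M.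
Proof.
move=> /compact_near_coveringP cK gK.
have : \forall i \near \oo,
    K `<=` (fun x => bounded_pseries (g x) i.+1%:R^-1 i.+1%:R).
  apply: cK => x /gK[delta d0 [M gM]].
  exists ((fun y => bounded_pseries (g y) delta M),
      [set i | i.+1%:R^-1 < delta /\ M <= i.+1%:R]); first split => //=.
    near=> i; split.
      by near: i; exact: (near_infty_natSinv_lt (PosNum d0)).
    rewrite (@le_trans _ _ i%:R)// ?ler_nat//; near: i; exact: nbhs_infty_ger.
  move=> [y i] [/= gy [id Mi]].
  by apply: (bounded_pseriesW _ _ _ _ _ _ (ltW id) Mi gy); rewrite invr_ge0.
move=> [i _ /(_ i (leqnn i)) gi]; exists i.+1%:R^-1; first by rewrite invr_gt0.
by exists i.+1%:R.
Unshelve. all: by end_near. Qed.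

(** * Trajectories of the radial equation *)

(** The function D(t)^2 exp (- 2 L (t - a)) is nonincreasing; squaring avoids
    differentiating an absolute value. *)
Lemma gronwall (D d : R -> R) (a b L : R) :
  {within `[a, b], continuous D} ->
  (forall t, a < t < b -> is_derive t 1 D (d t) /\ `|d t| <= L * `|D t|) ->
  forall t, a <= t <= b -> `|D t| <= `|D a| * expR (L * (t - a)).
Proof.
move=> cD dD t tab.
pose E s := (D s * D s) * expR ((- (2 * L)) * (s - a)).
have dE s : a < s < b -> is_derive s 1 E
   ((2 * D s * d s - 2 * L * (D s * D s)) * expR ((- (2 * L)) * (s - a))).
  move=> /dD[ds _].
  apply: is_derive_eq; rewrite /GRing.scale/=.
  ring.
have cE : {within `[a, b], continuous E}.
  move=> s; apply: cvgM; first by apply: cvgM; exact: cD.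
  apply: (continuous_subspaceT (f := fun z => expR (- (2 * L) * (z - a)))) => z.
  apply: (@continuous_comp _ _ _ (fun z => - (2 * L) * (z - a)) expR).
    apply: cvgM; first exact: cvg_cst.
    by apply: cvgB; [exact: cvg_id|exact: cvg_cst].
  exact: continuous_expR.
have aab : a <= a <= b.
  by move: tab; rewrite lexx => /andP[/le_trans]; apply.
have Eta : E t <= E a.
  apply: (@ler0_derive1_le_cc _ E a b _ _ cE); rewrite ?in_itv//=; last first.
  - by case/andP : tab.
  - move=> s; rewrite in_itv/= => sab; have [_ Es] := dE s sab.
    have [_ ds] := dD s sab.
    rewrite derive1E Es pmulr_lle0 ?expR_gt0// subr_le0.
    have : D s * d s <= L * (D s * D s).
      apply: le_trans (ler_norm _) _; rewrite normrM.
      rewrite -[D s * D s]expr2 -real_normK ?num_real// expr2 mulrCA.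
      by rewrite ler_wpM2l.
    lra.
  - by move=> s; rewrite in_itv/= => /dE[].
have : (D t) ^+ 2 <= (`|D a| * expR (L * (t - a))) ^+ 2.
  move: Eta; rewrite /E subrr mulr0 expR0 mulr1 exprMn real_normK ?num_real//.
  rewrite mulNr -[2 * L * _]mulrA expRN ler_pdivrMr ?expR_gt0// -!expr2.
  by rewrite mulr_natl mulr2n expRD -expr2.
by rewrite -(real_normK (num_real (D t))) ler_sqr// nnegrE mulr_ge0// expR_ge0.
Qed.

Lemma within_continuous_dist (x : R -> R) (a b : R) t e :
  {within `[a, b], continuous x} -> a <= t <= b -> 0 < e ->
  exists2 eta, 0 < eta &
    forall s, a <= s <= b -> `|t - s| < eta -> `|x t - x s| < e.
Proof.
move=> /subspace_continuousP cx tab e0.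
have /cvgrPdist_lt/(_ e e0) := cx t tab.
rewrite near_withinE => /nbhs_ballP[eta /= eta0 H]; exists eta => // s sab ts.
exact: H.
Qed.


Section Trajectories.
Variables (W : R -> R -> R) (T : R).

(** After the last time [t0] at which it is nonnegative, a trajectory that
    becomes negative starts from 0 and stays in the strip |x| < delta for a
    while.  There the field is at most M |x|, so Gronwall's inequality keeps
    the trajectory at 0. *)
Lemma trajectory_ge0 (delta M : R) (x : R -> R) : 0 < delta ->
  (forall t h, 0 <= t <= T -> `|h| < delta -> `|W t h| <= M) ->
  {within `[0, T], continuous x} ->
  (forall t, 0 < t < T -> is_derive t 1 x (x t * W t (x t))) ->
  0 <= x 0 -> forall t, 0 <= t <= T -> 0 <= x t.
Proof.
move=> d0 WM cx dx x0 t1 /andP[t10 t1T]; rewrite leNgt; apply/negP => xt1.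
pose A := [set t | 0 <= t <= t1 /\ 0 <= x t].
have A0 : A 0 by split=> //; rewrite lexx.
have supA : has_sup A by split; [exists 0|exists t1 => t [/andP[]]].
set t0 := sup A.
have t00 : 0 <= t0 by exact: (sup_upper_bound supA).
have t01 : t0 <= t1 by apply: ge_sup; [exists 0|move=> t [/andP[]]].
have t0T : 0 <= t0 <= T by rewrite t00 (le_trans t01).
have cx0 e : 0 < e -> exists2 eta, 0 < eta &
    forall s, 0 <= s <= T -> `|t0 - s| < eta -> `|x t0 - x s| < e.
  exact: within_continuous_dist.
have xt0 : 0 <= x t0.
  rewrite leNgt; apply/negP => xt0.
  have [|eta eta0 H] := cx0 (- x t0); first by rewrite oppr_gt0.
  have [s As ts] := sup_adherent eta0 supA.
  have st0 : s <= t0 by exact: (sup_upper_bound supA).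
  case: As => /andP[s0 st1] xs.
  have := H s _ _; rewrite s0 (le_trans st1)// ger0_norm ?subr_ge0//.
  rewrite ltrBlDr -ltrBlDl => /(_ isT ts).
  by rewrite ltr_norml => /andP[]; lra.
have xneg s : t0 < s -> s <= t1 -> x s < 0.
  move=> t0s st1; rewrite ltNge; apply/negP => xs.
  have : s <= t0; last by rewrite leNgt t0s.
  apply: (sup_upper_bound supA); split => //.
  by rewrite st1 (le_trans t00 (ltW t0s)).
have t0lt : t0 < t1.
  by rewrite lt_neqAle t01 andbT; apply: contraTneq xt0 => ->; rewrite -ltNge.
have right eta : 0 < eta -> exists s, [/\ t0 < s, s <= t1 & s < t0 + eta].
  move=> eta0; exists (Num.min t1 (t0 + eta / 2)).
  by rewrite lt_min ge_min gt_min lexx t0lt; split => //; lra.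
have x0E : x t0 = 0.
  apply/eqP; rewrite eq_le xt0 andbT leNgt; apply/negP => xt0p.
  have [eta eta0 H] := cx0 _ xt0p.
  have [s [t0s st1 sn]] := right _ eta0.
  have := H s _ _; rewrite (le_trans t00 (ltW t0s)) (le_trans st1)//.
  rewrite ler0_norm ?subr_le0 ?(ltW t0s)// opprB ltrBlDl => /(_ isT sn).
  by rewrite ltr_norml => /andP[]; have := xneg s t0s st1; lra.
have [eta eta0 H] := cx0 _ d0.
have [s [t0s st1 sn]] := right _ eta0.
have sT : s <= T by exact: le_trans st1 t1T.
have : `|x s| <= 0; last first.
  by rewrite normr_le0 => /eqP xs; have := xneg s t0s st1; lra.
apply: (@le_trans _ _ (`|x t0| * expR (M * (s - t0)))); last first.
  by rewrite x0E normr0 mul0r.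
apply: (gronwall x (fun t => x t * W t (x t)) t0 s); last first.
- by rewrite lexx ltW.
- move=> t /andP[t0t ts].
  have tT : 0 < t < T by rewrite (le_lt_trans t00)//= (lt_le_trans ts).
  split; first exact: dx.
  have tT' : 0 <= t <= T by case/andP: tT => *; rewrite !ltW.
  rewrite normrM mulrC ler_wpM2r// WM//.
  have := H t tT'; rewrite x0E sub0r normrN; apply.
  by rewrite ler0_norm; lra.
- apply: continuous_subspaceW cx => t /=; rewrite !in_itv/= => /andP[t0t ts].
  by rewrite (le_trans t00)//= (le_trans ts).
Qed.

Variables (eps delta M : R).
Hypotheses (e0 : 0 <= eps) (d0 : 0 < delta).
Hypothesis WM : forall t r, 0 <= t <= T -> 0 <= r <= eps ->
  bounded_pseries (fun h => W t (r + h)) delta M.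

Lemma field_bounded t r : 0 <= t <= T -> 0 <= r <= eps -> `|W t r| <= M.
Proof.
move=> tT re; have rr : `|r - r| < delta by rewrite subrr normr0.
have := bounded_pseries_taylor _ _ _ _ _ 0 d0 (WM _ _ tT re) rr.
by rewrite big_ord0 subr0 expr0 mulr1.
Qed.

(** The power series of [W t] about [b] compares [W t a] with [W t b] when
    [a] and [b] are less than [delta] apart; otherwise the bound 2 eps M on the
    difference of the values is at most 2 eps M / delta times |a - b|. *)
Lemma field_lipschitz t a b : 0 <= t <= T -> 0 <= a <= eps -> 0 <= b <= eps ->
  `|a * W t a - b * W t b| <= (M + 2 * (eps * M) / delta) * `|a - b|.
Proof.
move=> tT ae be; have Wa := field_bounded _ _ tT ae.
have Wb := field_bounded _ _ tT be.
have M0 : 0 <= M by exact: le_trans Wa.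
have [abd|dab] := ltP `|a - b| delta.
  have -> : a * W t a - b * W t b = (a - b) * W t a + b * (W t a - W t b).
    by ring.
  rewrite (le_trans (ler_normD _ _))// [leRHS]mulrDl lerD//.
    by rewrite normrM mulrC ler_wpM2r.
  have := bounded_pseries_taylor _ _ _ _ _ 1 d0 (WM _ _ tT be) abd.
  rewrite big_ord1 fact0 invr1 !mul1r derive1n0 expr1 => Wab.
  case/andP: be => b0 be.
  rewrite normrM (ger0_norm b0) (le_trans (ler_pM _ _ be Wab))//.
  rewrite -subr_ge0.
  have -> : 2 * (eps * M) / delta * `|a - b| - eps * (M * (`|a - b| / delta)) =
      eps * M * `|a - b| / delta by ring.
  by rewrite divr_ge0 ?mulr_ge0// ltW.
have aW : `|a * W t a| <= eps * M.
  by case/andP: ae => a0 ae; rewrite normrM (ger0_norm a0) ler_pM.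
have bW : `|b * W t b| <= eps * M.
  by case/andP: be => b0 be; rewrite normrM (ger0_norm b0) ler_pM.
rewrite (le_trans (ler_normB _ _))// (le_trans (lerD aW bW))//.
rewrite mulrDl ler_wpDl ?mulr_ge0//.
have -> : 2 * (eps * M) / delta * `|a - b| = 2 * (eps * M * (`|a - b| / delta)).
  by ring.
have : eps * M <= eps * M * (`|a - b| / delta).
  by rewrite ler_peMr ?mulr_ge0// ler_pdivlMr// mul1r.
lra.
Qed.

Lemma trajectories_gap (x y : R -> R) :
  {within `[0, T], continuous x} -> {within `[0, T], continuous y} ->
  (forall t, 0 < t < T -> is_derive t 1 x (x t * W t (x t))) ->
  (forall t, 0 < t < T -> is_derive t 1 y (y t * W t (y t))) ->
  (forall t, 0 <= t <= T -> 0 <= x t <= eps) ->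
  (forall t, 0 <= t <= T -> 0 <= y t <= eps) ->
  forall t, 0 <= t <= T ->
    `|x t - y t| <= `|x 0 - y 0| * expR ((M + 2 * (eps * M) / delta) * t).
Proof.
move=> cx cy dx dy xe ye t tT.
have := gronwall (x - y) (fun t => x t * W t (x t) - y t * W t (y t)) 0 T
  (M + 2 * (eps * M) / delta) (within_continuousB cx cy) _ t tT.
rewrite subr0; apply=> s sT.
have sT' : 0 <= s <= T by case/andP: sT => *; rewrite !ltW.
split; last exact: field_lipschitz sT' (xe _ sT') (ye _ sT').
by apply: is_deriveB; [exact: dx|exact: dy].
Qed.

End Trajectories.
End Taylor.

(** * Expansions on the cylinder *)

Section Cylinder.
Context {R : realType}.

Lemma compact_cylinder (e : R) : compact (cylinder e).
Proof.
have -> : cylinder e = `[0, 2 * pi] `*` `[0, e].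
  by apply/seteqP; split => -[t r] /=; rewrite /cylinder/= !in_itv.
by apply: compact_setX; exact: segment_compact.
Qed.

Lemma polar_bounded_pseries (f : R -> R -> R) (e : R) :
  (forall th r, cylinder e (th, r) ->
     analytic_at (of_row2 f) (row2 (r * cos th) (r * sin th))) ->
  exists2 delta, 0 < delta & exists M, forall th r, cylinder e (th, r) ->
    bounded_pseries (fun h => polar f th (r + h)) delta M.
Proof.
move=> fa; pose g (p : R * R) h := polar f p.1 (p.2 + h).
have [] := @compact_bounded_pseries R (R * R)%type (cylinder e) g
  (compact_cylinder e); last first.
  by move=> delta d0 [M gM]; exists delta => //; exists M => th r /gM.
move=> [th0 r0] /fa/row2_along_lines[delta d0 [M fM]].
exists delta => //; exists M.
have cc : (fun p : R * R => p.2 * cos p.1) @ (th0, r0) --> r0 * cos th0.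
  apply: cvgM; first exact: cvg_snd.
  by apply: (cvg_comp _ _ (@cvg_fst _ _ _ _ _)); exact: continuous_cos.
have cs : (fun p : R * R => p.2 * sin p.1) @ (th0, r0) --> r0 * sin th0.
  apply: cvgM; first exact: cvg_snd.
  by apply: (cvg_comp _ _ (@cvg_fst _ _ _ _ _)); exact: continuous_sin.
near=> p.
have -> : g p =
    fun h => f (p.2 * cos p.1 + h * cos p.1) (p.2 * sin p.1 + h * sin p.1).
  by apply/funext => h; rewrite /g /polar !mulrDl.
apply: fM; rewrite 1?distrC.
- by near: p; move/cvgrPdist_le : cc; apply.
- by near: p; move/cvgrPdist_le : cs; apply.
- by rewrite ler_norml cos_geN1 cos_le1.
- by rewrite ler_norml sin_geN1 sin_le1.
Unshelve. all: by end_near. Qed.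

Lemma radial_bounded_pseries (W : R -> R -> R) (e : R) :
  (forall th r, cylinder e (th, r) -> analytic_at (of_row2 W) (row2 th r)) ->
  exists2 delta, 0 < delta & exists M, forall th r, cylinder e (th, r) ->
    bounded_pseries (fun h => W th (r + h)) delta M.
Proof.
move=> Wa; pose g (p : R * R) h := W p.1 (p.2 + h).
have [] := @compact_bounded_pseries R (R * R)%type (cylinder e) g
  (compact_cylinder e); last first.
  by move=> delta d0 [M gM]; exists delta => //; exists M => th r /gM.
move=> [th0 r0] /Wa/row2_along_lines[delta d0 [M WM]].
exists delta => //; exists M.
have c1 : (fun p : R * R => p.1) @ (th0, r0) --> th0 by exact: cvg_fst.
have c2 : (fun p : R * R => p.2) @ (th0, r0) --> r0 by exact: cvg_snd.
near=> p.
have -> : g p = fun h => W (p.1 + h * 0) (p.2 + h * 1).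
  by apply/funext => h; rewrite mulr0 mulr1 addr0.
apply: WM; rewrite 1?distrC ?normr0 ?normr1//.
- by near: p; move/cvgrPdist_le : c1; apply.
- by near: p; move/cvgrPdist_le : c2; apply.
Unshelve. all: by end_near. Qed.

(** * Convergence of the patchy approximation *)

(** A point above the lower boundary of the [j]-th patch and outside of that
    patch is above the lower boundary of the next one.  Since [x] is above the
    innermost boundary and not above the outermost one, some patch contains it,
    whatever the order of the curves. *)
Lemma patchyE n (psi : R -> R -> 'cV[R]_n) N (r : nat -> R -> R) k th x :
  0 <= x <= r k th -> exists2 j : 'I_k.+1,
    prev_curve r j th <= x <= r j th &
    patchy psi N r k th x = radial_taylor psi N (prev_curve r j) th x.
Proof.
move=> /andP[x0 xr]; rewrite /patchy; case: pickP => [j /andP[jx xj]|none].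
  by exists j => //; rewrite jx (lteifW xj).
have prev j : (j <= k)%N -> prev_curve r j th <= x.
  elim: j => [|j IH] jk //=.
  have := none (Ordinal (leqW jk)); rewrite /in_patch/= (IH (ltnW jk))/=.
  by rewrite (ltn_eqF jk)/= ltNge => /negbFE.
have := none ord_max; rewrite /in_patch/= prev// eqxx /=.
by rewrite xr.
Qed.

End Cylinder.

Theorem theorem3p1 (R : realType) (n : nat) (B : 'M[R]_n)
    (P Q : R -> R -> R) (Z : R -> R -> 'cV[R]_n -> 'cV[R]_n)
    (U : set (R * R)) (phi : R -> R -> 'cV[R]_n)
    (eps teps : R) (rho : R -> R -> R) (N : nat)
    (hP : analytic_order2 (of_row2 P))
    (hQ : analytic_order2 (of_row2 Q))
    (hZ : forall i, analytic_order2 (of_row2n (fun x y z => Z x y z i 0)))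
    (hB : hyperbolic B)
    (hstable : lyapunov_stable P Q)
    (hnonattr : ~ attractive P Q)
    (hphi : local_center_manifold P Q B Z U phi)
    (* psi is defined on Omega *)
    (hU : forall th r, cylinder eps (th, r) -> U (r * cos th, r * sin th))
    (hTheta : forall th r, cylinder eps (th, r) -> 0 < 1 + Thetahat P Q th r)
    (hR : forall th r, cylinder eps (th, r) ->
       analytic_at (of_row2 (radialR P Q)) (row2 th r))
    (hteps : 0 < teps < eps)
    (htraj : forall r : R -> R, radial_trajectory P Q r -> 0 <= r 0 <= teps ->
       forall th, 0 <= th <= 2 * pi -> r th < eps)
    (* rho a is the solution of the radial equation with initial value a *)
    (hrho : forall a, 0 <= a <= teps ->
       radial_trajectory P Q (rho a) /\ rho a 0 = a)
    (hN : (1 <= N)%N) :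
  let psi := polar phi in
  let step (k i : nat) : R := teps / k.+1%:R in
  let r (k j : nat) : R -> R := rho (\sum_(i < j.+1) step k i) in
  {uniform region_below (rho teps),
     (fun (k : nat) (p : R * R) => patchy psi N (r k) k p.1 p.2) @ \oo -->
     (fun p : R * R => psi p.1 p.2)}.
Proof.
move=> psi step r; case/andP: hteps => teps0 teps_eps.
have [_ _ _ phian _] := hphi.
have cyl (th x : R) :
  0 <= th <= 2 * pi -> 0 <= x <= eps -> cylinder eps (th, x).
  by [].
have psiM i : exists2 delta, 0 < delta & exists M, forall th x,
    cylinder eps (th, x) ->
    bounded_pseries (fun h => psi th (x + h) i 0) delta M.
  have [th x /hU Up|delta d0 [M psiM]] :=
    @polar_bounded_pseries R (fun a b => phi a b i 0) eps.
    exact: phian.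
  by exists delta => //; exists M.
have [delta d0 [M WM]] := radial_bounded_pseries _ _ hR.
have WM' (th x : R) : 0 <= th <= 2 * pi -> 0 <= x <= eps ->
  bounded_pseries (fun h => radialR P Q th (x + h)) delta M.
  by move=> ? ?; exact: WM.
have eps0 : 0 <= eps by rewrite ltW// (lt_trans teps0).
have trajP (s : R -> R) : radial_trajectory P Q s -> forall th,
    0 < th < 2 * pi -> is_derive th 1 s (s th * radialR P Q th (s th)).
  by move=> [_ ds] th thT; apply: ds; rewrite inE /= in_itv.
(* The expansion of the radial field about r = 0 also bounds it for small
   negative r. *)
have inside (s : R -> R) : radial_trajectory P Q s -> 0 <= s 0 <= teps ->
    forall th, 0 <= th <= 2 * pi -> 0 <= s th <= eps.
  move=> hs s0 th thT; rewrite (ltW (htraj s hs s0 th thT)) andbT.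
  have [cs _] := hs; case/andP: s0 => s0 _.
  apply: (@trajectory_ge0 _ (radialR P Q) (2 * pi) delta M s d0 _ cs
    (trajP _ hs)) => //.
  move=> t h tT hd; have h0 : `|h - 0| < delta by rewrite subr0.
  have z0 : 0 <= (0:R) <= eps by rewrite lexx.
  have := bounded_pseries_taylor _ _ _ _ _ 0 d0 (WM' _ _ tT z0) h0.
  by rewrite big_ord0 subr0 expr0 mulr1.
pose L := M + 2 * (eps * M) / delta.
have M0 : 0 <= M.
  have [d /(_ 0%N)] : bounded_pseries (fun h => radialR P Q 0 (0 + h)) delta M.
    by apply: WM'; rewrite lexx ?mulr_ge0 ?pi_ge0.
  by rewrite big_ord0.
have L0 : 0 <= L by rewrite addr_ge0// divr_ge0 ?mulr_ge0// ltW.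
(* Gronwall's bound over [0, 2 pi] for two curves that start one step apart. *)
pose gap (k : nat) := teps / k.+1%:R * expR (L * (2 * pi)).
have gap_cvg : gap @ \oo --> 0.
  rewrite -[X in _ --> X](mul0r (expR (L * (2 * pi)))); apply: cvgM.
    rewrite -(mulr0 teps); apply: cvgM; first exact: cvg_cst.
    exact: cvg_harmonic.
  exact: cvg_cst.
have sumE k j : \sum_(i < j.+1) step k i = teps * (j.+1%:R / k.+1%:R).
  by rewrite /step sumr_const card_ord -[LHS]mulr_natr -mulrA [_^-1 * _]mulrC.
have start k j : (j <= k.+1)%N -> 0 <= teps * (j%:R / k.+1%:R) <= teps.
  move=> jk; rewrite mulr_ge0 ?divr_ge0 ?(ltW teps0)//=.
  by rewrite ger_pMr// ler_pdivrMr// mul1r ler_nat.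
have rP k j : (j <= k)%N -> radial_trajectory P Q (r k j) /\
    r k j 0 = teps * (j.+1%:R / k.+1%:R).
  by move=> jk; rewrite -sumE; apply: hrho; rewrite sumE; exact: start.
have prevP k j : (j <= k)%N -> radial_trajectory P Q (prev_curve (r k) j) /\
    prev_curve (r k) j 0 = teps * (j%:R / k.+1%:R).
  case: j => [|j] jk; last by apply: rP; exact: ltnW.
  (* The innermost boundary r = 0 is a constant trajectory. *)
  rewrite /= mul0r mulr0; split=> //; split.
    by apply: continuous_subspaceT => z; exact: cst_continuous.
  by move=> th _; rewrite mul0r; exact: is_derive_cst.
have gapP k j th : (j <= k)%N -> 0 <= th <= 2 * pi ->
    `|r k j th - prev_curve (r k) j th| <= gap k.
  move=> jk thT; have [hr r0] := rP _ _ jk; have [hp p0] := prevP _ _ jk.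
  have := @trajectories_gap R _ _ _ _ _ eps0 d0 WM' _ _ (proj1 hr) (proj1 hp)
    (trajP _ hr) (trajP _ hp) (inside _ hr _) (inside _ hp _) th thT.
  rewrite r0 p0 !start ?ltnS ?(leqW jk) // => /(_ isT isT)/le_trans; apply.
  rewrite -mulrBr -mulrBl -natr1 addrAC subrr add0r mul1r.
  rewrite ger0_norm ?divr_ge0 ?(ltW teps0)// ler_wpM2l ?divr_ge0 ?(ltW teps0)//.
  by rewrite ler_expR ler_wpM2l//; case/andP: thT.
have close e : 0 < e -> \forall k \near \oo, forall i p,
    region_below (rho teps) p ->
    `|psi p.1 p.2 i 0 - patchy psi N (r k) k p.1 p.2 i 0| < e.
  have FF : Filter (\oo : set_system nat) by exact: _.
  move=> e0; apply: (filter_forall FF) => i.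
  have [di di0 [Mi psii]] := psiM i.
  have cgap : (fun k => Mi * (gap k / di)) @ \oo --> 0.
    rewrite -(mulr0 Mi) -(mul0r di^-1); apply: cvgM; first exact: cvg_cst.
    by apply: cvgM => //; exact: cvg_cst.
  near=> k => -[th x] [/= thT /andP[x0 xr]].
  have gapd : gap k < di.
    rewrite (le_lt_trans (ler_norm _))//; near: k.
    move/cvgrPdist_lt : gap_cvg => /(_ _ di0).
    by apply: filterS => k; rewrite sub0r normrN.
  have Mgap : Mi * (gap k / di) < e.
    rewrite (le_lt_trans (ler_norm _))//; near: k.
    move/cvgrPdist_lt : cgap => /(_ _ e0).
    by apply: filterS => k; rewrite sub0r normrN.
  have rk : rho teps = r k k by rewrite /r sumE divff ?mulr1// pnatr_eq0.
  have [|j /andP[px xj] ->] := @patchyE R n psi N (r k) k th x.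
    by rewrite -rk x0.
  have jk : (j <= k)%N by rewrite -ltnS.
  have [hp p0] := prevP _ _ jk.
  set c := prev_curve (r k) j th in px *.
  have cc : cylinder eps (th, c).
    by apply: cyl => //; apply: inside hp _ _ thT; rewrite p0 start// leqW.
  have xc : `|x - c| <= gap k.
    rewrite ger0_norm ?subr_ge0//; apply: le_trans (gapP _ _ _ jk thT).
    by apply: le_trans (ler_norm _); rewrite lerB.
  apply: le_lt_trans Mgap.
  have Mi0 : 0 <= Mi.
    by have [d /(_ 0%N) + _] := psii _ _ cc; rewrite big_ord0.
  apply: (le_trans (@bounded_pseries_taylor_cV R n (psi th) c di Mi x N.+1 i _
    di0 (psii _ _ cc) _)).
  - move=> l; have [dl dl0 [Ml psil]] := psiM l; exists dl => //; exists Ml.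
    exact: psil.
  - exact: le_lt_trans gapd.
  rewrite ler_wpM2l// (@le_trans _ _ (`|x - c| / di))//.
    rewrite exprS ler_piMr ?divr_ge0 ?(ltW di0)//.
    rewrite exprn_ile1 ?divr_ge0 ?(ltW di0)// ler_pdivrMr// mul1r.
    by rewrite (le_trans xc)// ltW.
  by rewrite ler_wpM2r// invr_ge0 ltW.
move=> A /uniform_nbhs[E [/= entE EA]].
move: entE; rewrite -entourage_ballE => -[/= e e0 eE].
have := close e e0; apply: filterS => k ck; apply: EA => p pin; apply: eE.
split=> // i j; rewrite ord1; exact: ck.
Unshelve. all: by end_near. Qed.
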